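(* Let $d\ge 2$. If $P$ is any boundedly finite supersaturable property (of measurable subsets of $\mathbb{R}^d$), then there is a set $A$ with property $P$ such that for any nonempty open bounded set $\Omega\subset\mathbb{R}^d$ $$\lim_{t\to\infty} d_{t\cdot \Omega}(A)=m(P).$$
   Context: Let $\mathfrak{M}(\mathbb{R}^d)$ be the family of Lebesgue measurable subsets of $\mathbb{R}^d$, $|\cdot|$ Lebesgue measure, $Q(x,r)$ the open axis-parallel cube of side length $r$ centered at $x$. A property is a function $P\colon\mathfrak{M}(\mathbb{R}^d)\to\{0,1\}$; $A$ has $P$ if $P(A)=1$. Put $d_\Omega(A)=|A\cap\Omega|/|\Omega|$, $t\cdot\Omega=\{tx:x\in\Omega\}$, $\bar d(A)=\limsup_{R\to\infty}d_{Q(0,R)}(A)$, $m(P)=\sup_{P(A)=1}\bar d(A)$, and $\mathcal{Z}_\delta(\varepsilon)A=\{x\in\mathbb{R}^d : |Q(x,\delta)\cap A|>\varepsilon|Q(x,\delta)|\}$ for $\delta,\varepsilon>0$. Supersaturable: $P$ is supersaturable if there is a function $I_P\colon\mathfrak{M}(\mathbb{R}^d)\to[0,\infty]$ (a saturation function for $P$) such that: (I) $0<m(P)$. (II) If $A\supset B$ then $I_P(A)\ge I_P(B)$ and $P(A)\le P(B)$. (III) $I_P(A)>0$ implies that $A$ does not have $P$. (IV) $P(A)=P(A+x)$ and $I_P(A)=I_P(A+x)$ for every $x\in\mathbb{R}^d$. (V) There is a real number $\operatorname{diam}(P)$ such that if $A_1,A_2$ are at distance at least $\operatorname{diam}(P)$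 from each other, then $I_P(A_1\cup A_2)\ge I_P(A_1)+I_P(A_2)$, and $A_1\cup A_2$ has $P$ iff both $A_1$ and $A_2$ have $P$. (VI) There are $\varepsilon>0$ (with $1-\varepsilon>0$) and a strictly positive function $f$ such that if $\mathcal{Z}_\delta(1-\varepsilon)A$ does not have $P$, then $I_P(A)\ge f(\delta)$. (VII) If $A\subset Q(0,R)$ then $I_P(A)\ge g_P(\varepsilon)I_P(\mathcal{Z}_\delta(\varepsilon)A)-h_P(\varepsilon,\delta)R^d$, where $g_P$ is positive and $h_P(\varepsilon,\delta)\to0$ as $\delta\to0$ for any fixed $\varepsilon>0$. Boundedly finite: $P$ is finite if there is a family $\mathcal{P}$ of finite sets such that $A$ has $P$ iff no set in $\mathcal{P}$ is a subset of $A$; it is boundedly finite if in addition the diameters of the sets in $\mathcal{P}$ are bounded. *)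

(* Defs.v *)
From HB Require Import structures.
From mathcomp Require Import all_boot all_order all_algebra.
From mathcomp Require Import all_classical all_reals all_analysis.

Set Implicit Arguments.
Unset Strict Implicit.
Unset Printing Implicit Defensive.

Import Order.TTheory GRing.Theory Num.Theory.
Import numFieldNormedType.Exports.

Local Open Scope classical_set_scope.
Local Open Scope ring_scope.

Section lebesgue_Rd.
Context {R : realType} {d : nat}.
Implicit Types (a b : 'rV[R]_d) (A : set 'rV[R]_d).

Definition box a b : set 'rV[R]_d :=
  [set x | forall i, a 0 i < x 0 i <= b 0 i].

(* This is the volume of [box a b] only when [a] is below [b] coordinatewise. *)
Definition box_volume a b : R := \prod_(i < d) (b 0 i - a 0 i).

(* The library has no Lebesgue measure on R^d for d > 1: we take the usual outer
   measure (infimum of the total volume over countable covers by boxes) and its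
   Caratheodory-measurable sets. *)
Definition box_cover A (a b : nat -> 'rV[R]_d) : Prop :=
  (forall k i, a k 0 i <= b k 0 i) /\ A `<=` \bigcup_k box (a k) (b k).

Definition lebesgue_Rd A : \bar R :=
  ereal_inf [set s | exists a b : nat -> 'rV[R]_d, box_cover A a b /\
    s = (\sum_(0 <= k <oo) (box_volume (a k) (b k))%:E)%E].

Definition lebesgue_measurable A : Prop := lebesgue_Rd.-caratheodory A.

End lebesgue_Rd.

Section densities.
Context {R : realType} {d : nat}.
Implicit Types (x y : 'rV[R]_d) (A Omega : set 'rV[R]_d).

(* [r] is the side length, not the half-side. *)
Definition cube x (r : R) : set 'rV[R]_d :=
  [set y | forall i, `|y 0 i - x 0 i| < r / 2].

(* The norm that the library puts on 'rV[R]_d is the sup norm, so the Euclidean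
   distance is spelled out. *)
Definition euclidean_dist x y : R :=
  Num.sqrt (\sum_(i < d) (x 0 i - y 0 i) ^+ 2).

Definition translate x A : set 'rV[R]_d := [set a + x | a in A].

Definition dilate (t : R) A : set 'rV[R]_d := [set t *: a | a in A].

Definition density Omega A : \bar R :=
  (lebesgue_Rd (A `&` Omega) / lebesgue_Rd Omega)%E.

Definition upper_density A : \bar R :=
  limf_esup (fun r : R => density (cube 0 r) A) +oo.

Definition zooming_out (delta eps : R) A : set 'rV[R]_d :=
  [set x | (eps%:E * lebesgue_Rd (cube x delta)
            < lebesgue_Rd (cube x delta `&` A))%E].

(* A property is a boolean function of which only the values on measurable sets
   are ever used. *)
Definition max_density (P : set 'rV[R]_d -> bool) : \bar R :=
  ereal_sup [set upper_density A | A in [set A | lebesgue_measurable A /\ P A]].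

End densities.

Section properties.
Context {R : realType} {d : nat}.
Implicit Types (x y : 'rV[R]_d) (A B : set 'rV[R]_d) (P : set 'rV[R]_d -> bool).

Definition far_apart (D : R) A B : Prop :=
  forall x y, A x -> B y -> D <= euclidean_dist x y.

Record saturation_function P (I : set 'rV[R]_d -> \bar R) : Prop := {
  sat_ge0 : forall A, lebesgue_measurable A -> (0 <= I A)%E;
  sat_max_density_gt0 : (0 < max_density P)%E;
  sat_monotone : forall A B,
    lebesgue_measurable A -> lebesgue_measurable B -> B `<=` A ->
    (I B <= I A)%E /\ (P A -> P B);
  sat_gt0 : forall A, lebesgue_measurable A -> (0 < I A)%E -> ~~ P A;
  sat_translate : forall A x, lebesgue_measurable A ->
    P (translate x A) = P A /\ I (translate x A) = I A;
  sat_diam : exists D : R, forall A1 A2,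
    lebesgue_measurable A1 -> lebesgue_measurable A2 -> far_apart D A1 A2 ->
    (I A1 + I A2 <= I (A1 `|` A2))%E /\
    (P (A1 `|` A2) <-> P A1 /\ P A2);
  sat_supersaturation : exists (eps : R) (f : R -> R),
    [/\ 0 < eps, 0 < 1 - eps, (forall delta, 0 < delta -> 0 < f delta) &
      forall delta A, 0 < delta -> lebesgue_measurable A ->
        ~~ P (zooming_out delta (1 - eps) A) -> ((f delta)%:E <= I A)%E];
  sat_zooming_out : exists (g : R -> R) (h : R -> R -> R),
    [/\ (forall eps, 0 < eps -> 0 < g eps),
        (forall eps, 0 < eps -> h eps delta @[delta --> 0^'+] --> 0) &
      forall eps delta r A, 0 < eps -> 0 < delta -> 0 < r ->
        lebesgue_measurable A -> A `<=` cube 0 r ->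
        ((g eps)%:E * I (zooming_out delta eps A) - (h eps delta * r ^+ d)%:E
          <= I A)%E]
}.

Definition supersaturable P : Prop := exists I, saturation_function P I.

Definition boundedly_finite P : Prop :=
  exists F : set (set 'rV[R]_d),
    [/\ (forall S, F S -> finite_set S),
        (exists M : R, forall S x y, F S -> S x -> S y ->
          euclidean_dist x y <= M) &
      forall A, lebesgue_measurable A ->
        (P A <-> ~ exists2 S, F S & S `<=` A)].

End properties.

(* Main.v *)
Require Import Defs.
From HB Require Import structures.
From mathcomp Require Import all_boot all_order all_algebra.
From mathcomp Require Import all_classical all_reals all_analysis.
From mathcomp Require Import ring lra.

Set Implicit Arguments.
Unset Strict Implicit.
Unset Printing Implicit Defensive.

Import Order.TTheory GRing.Theory Num.Theory.
Import numFieldNormedType.Exports.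

Local Open Scope classical_set_scope.
Local Open Scope ring_scope.

(** Write [m] for the maximal density of [P] and [D] for its diameter.

    Since [P] is a finite property, a union of countably many sets that have [P]
    and lie at mutual distance at least [D] has [P]: a forbidden finite set inside
    the union would already sit inside finitely many of the pieces, whose union has
    [P]. This locality, together with monotonicity and translation
    invariance, drives the proof; it is collected in [local_property].

    The first consequence is that [m] is governed by single cubes. A set with [P]
    inside a cube of side [s] can be repeated with period [s + D]
    ([periodic_copies]), which costs only a factor [(s / (s + D)) ^ d] in density.
    Hence for large [s] every set with [P] has density at most [m + e] in every
    cube of side [s] ([lebesgue_le_max_density]); and a set with [P] that is dense
    in one huge cube yields one whose density is at least [m - e] in all large
    centred cubes ([dense_in_large_cubes]).

    To reach [m] itself, take such sets with [e = 1 / (k + 1)] and use the [k]-th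
    one in the shell between two centred cubes of sides [rad k + 2 D] and
    [rad k.+1]. The gaps keep the pieces [D] apart, and when the radii grow fast
    enough the union has density tending to [m] along all centred cubes
    ([attaining_centred_cubes]).

    Passing from centred cubes to an open bounded [Omega] costs nothing, because the
    upper bound holds in every cube. Cut a big cube around [Omega] into small equal
    cells. The cells inside [Omega] fill it up to a small error, so the density in
    the dilates of [Omega] is at most [m + e]. The remaining cells, too, receive at
    most their share, so what is left for [Omega] out of the mass in the big cube is
    at least its own share ([density_dilate_cvg]).

    As for the measure, the outer measure is scaled by [t ^ d] under
    [x |-> t x + y], so a cube of side [s] has volume [c s ^ d] with [c] the volume
    of the unit cube; [c] is positive because a null unit cube would make all
    densities, hence [m], vanish ([cube_unit_gt0]). *)

(** * The outer measure of Lebesgue *)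

Section outer_measure.
Context {R : realType} {d : nat}.
Notation V := 'rV[R]_d.+1.
Implicit Types (a b : V) (A : set V).

Lemma box_volume_ge0 a b :
  (forall i, a 0 i <= b 0 i) -> (0 <= (box_volume a b)%:E)%E.
Proof.
by move=> ab; rewrite lee_fin; apply: prodr_ge0 => i _; rewrite subr_ge0.
Qed.

Lemma box_cover_vol_ge0 A (a b : nat -> V) : box_cover A a b ->
  forall k, (0 <= (box_volume (a k) (b k))%:E)%E.
Proof. by move=> [ab _] k; apply: box_volume_ge0 => i; exact: ab. Qed.

Lemma le_lebesgue_Rd A (a b : nat -> V) : box_cover A a b ->
  (lebesgue_Rd A <= \sum_(0 <= k <oo) (box_volume (a k) (b k))%:E)%E.
Proof. by move=> c; apply: ereal_inf_lbound; exists a, b. Qed.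

Lemma lebesgue_Rd_ge (l : \bar R) A :
  (forall a b : nat -> V, box_cover A a b ->
    (l <= \sum_(0 <= k <oo) (box_volume (a k) (b k))%:E)%E) ->
  (l <= lebesgue_Rd A)%E.
Proof. by move=> h; apply: le_ereal_inf_tmp => _ [a [b [c ->]]]; exact: h. Qed.

Lemma lebesgue_Rd_ge0 A : (0 <= lebesgue_Rd A)%E.
Proof.
apply: lebesgue_Rd_ge => a b c; apply: nneseries_ge0 => k _ _.
exact: box_cover_vol_ge0 c k.
Qed.

Lemma box_volume_xx a : box_volume a a = 0.
Proof. by rewrite /box_volume (bigD1 ord0)//= subrr mul0r. Qed.

(** A single box covers itself once the sequence is padded by degenerate boxes;
    these have volume zero only in positive dimension. *)
Lemma lebesgue_Rd_box_le a b : (forall i, a 0 i <= b 0 i) ->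
  (lebesgue_Rd (box a b) <= (box_volume a b)%:E)%E.
Proof.
move=> ab.
have c : box_cover (box a b) (fun=> a) (fun k => if k is 0%N then b else a).
  split; first by move=> [|k] i /=.
  by move=> x xab; exists 0%N.
apply: (le_trans (le_lebesgue_Rd c)).
rewrite nneseries_recl//; last by move=> k _; exact: box_cover_vol_ge0 c k.
rewrite eseries0 ?adde0// => -[|k]//= _ _; by rewrite box_volume_xx.
Qed.

Lemma lebesgue_Rd0 : lebesgue_Rd (set0 : set V) = 0%E.
Proof.
apply/eqP; rewrite eq_le lebesgue_Rd_ge0 andbT.
have c : box_cover set0 (fun=> 0 : V) (fun=> 0) by split.
apply: (le_trans (le_lebesgue_Rd c)).
by rewrite eseries0// => k _ _; rewrite box_volume_xx.
Qed.

Lemma lebesgue_Rd_le : {homo @lebesgue_Rd R d.+1 : A B / A `<=` B >-> (A <= B)%E}.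
Proof.
move=> A B AB; apply: lebesgue_Rd_ge => a b [ab cov]; apply: le_lebesgue_Rd.
by split => //; exact: subset_trans AB cov.
Qed.

Local Open Scope ereal_scope.

(** Covers of the pieces that are optimal up to [e / 2 ^ n.+1] are merged into one
    cover of the union along a bijection of [nat] with [nat * nat]. *)
Lemma lebesgue_Rd_sigma_subadditive : sigma_subadditive (@lebesgue_Rd R d.+1).
Proof.
move=> A; have [[i ioo]|] := pselect (exists i, lebesgue_Rd (A i) = +oo).
  rewrite (eseries_pinfty _ _ ioo) ?leey// => n _.
  by rewrite -ltNye (lt_le_trans _ (lebesgue_Rd_ge0 _)).
rewrite -forallNE => Aoo.
suff add2e (e : {posnum R}) : lebesgue_Rd (\bigcup_n A n) <=
    \sum_(i <oo) lebesgue_Rd (A i) + e%:num%:E.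
  by apply/lee_addgt0Pr => _/posnumP[].
rewrite (le_trans _ (epsilon_trick _ _ _))//; last first.
  by move=> n; exact: lebesgue_Rd_ge0.
pose vol (G : nat -> V * V) k := (box_volume (G k).1 (G k).2)%:E.
pose C n (G : nat -> V * V) := box_cover (A n) (fst \o G) (snd \o G) /\
  \sum_(k <oo) vol G k <= lebesgue_Rd (A n) + (e%:num / (2 ^ n.+1)%:R)%:E.
have [G PG] : {G : nat -> nat -> V * V & forall n, C n (G n)}.
  apply: (@choice _ _ C) => n.
  have fA : lebesgue_Rd (A n) \is a fin_num.
    by rewrite ge0_fin_numE ?lebesgue_Rd_ge0// ltey; apply/eqP/Aoo.
  have en1 : (0 < e%:num / (2 ^ n.+1)%:R)%R by [].
  have [_ [a [b [c ->]]] /ltW s] := lb_ereal_inf_adherent en1 fA.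
  by exists (fun k => (a k, b k)).
have vol_ge0 n k : 0 <= vol (G n) k by exact: box_cover_vol_ge0 (PG n).1 k.
have /card_esym/ppcard_eqP[f] := card_nat2.
have cov : box_cover (\bigcup_n A n) (fun k => (G (f k).1 (f k).2).1)
    (fun k => (G (f k).1 (f k).2).2).
  split => [k i|x [n _ Anx]]; first exact: (PG (f k).1).1.1.
  have [k _ xk] := (PG n).1.2 _ Anx.
  by exists (f^-1%FUN (n, k)) => //=; rewrite invK ?inE.
apply: (le_trans (le_lebesgue_Rd cov)).
apply: (@le_trans _ _ (\sum_(n <oo) \sum_(k <oo) vol (G n) k)).
  rewrite nneseries_esumT; last by move=> k; exact: vol_ge0.
  rewrite -(@reindex_esum _ _ _ [set: nat] [set: nat * nat] f
    (fun nk => vol (G nk.1) nk.2)); last by [].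
  rewrite nneseries_esumT; last by move=> n; exact: nneseries_ge0.
  under [X in _ <= X]eq_esum do rewrite nneseries_esumT//.
  rewrite esum_esum//; set S := (X in _ <= esum X _); suff -> : S = setT by [].
  by apply/seteqP; split=> -[n k] _.
apply: lee_nneseries => [n _ _|n _]; first exact: nneseries_ge0.
exact: (PG n).2.
Qed.

HB.instance Definition _ := isOuterMeasure.Build R V (@lebesgue_Rd R d.+1)
  lebesgue_Rd0 lebesgue_Rd_ge0 lebesgue_Rd_le lebesgue_Rd_sigma_subadditive.

End outer_measure.


Section measure.
Context (R : realType) (d : nat).

Let outer : {outer_measure set 'rV[R]_d.+1 -> \bar R} := @lebesgue_Rd R d.+1.

(** The outer measure seen as a measure on its Caratheodory sigma-algebra, to which
    the general theory of measures applies. *)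
Definition lebesgue : {measure set (caratheodory_type (@lebesgue_Rd R d.+1)) -> \bar R} :=
  (outer : set (caratheodory_type outer) -> \bar R).

Lemma lebesgueE A : lebesgue A = lebesgue_Rd A.
Proof. by []. Qed.

End measure.

(** * Measurable sets *)

Section measurable_sets.
Context {R : realType} {d : nat}.
Notation V := 'rV[R]_d.+1.
Implicit Types (a b x y : V) (A : set V) (i : 'I_d.+1).

Let lebesgue_measurableE A :
  lebesgue_measurable A = measurable (A : set (caratheodory_type (@lebesgue_Rd R d.+1))).
Proof. by []. Qed.

Let row_with a i (c : R) : V := \row_j (if j == i then c else a 0 j).

Lemma box_volume_split a b i (t : R) : box_volume a b =
  box_volume a (row_with b i t) + box_volume (row_with a i t) b.
Proof.
pose r := \prod_(j < d.+1 | j != i) (b 0 j - a 0 j).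
have volE a' b' : (forall j, j != i -> b' 0 j - a' 0 j = b 0 j - a 0 j) ->
    box_volume a' b' = (b' 0 i - a' 0 i) * r.
  by move=> e; rewrite /box_volume (bigD1 i)//=; congr (_ * _); apply: eq_bigr.
rewrite !volE//; try by move=> j /negPf ji; rewrite mxE ji.
by rewrite !mxE eqxx; ring.
Qed.

(** The hyperplane at height [c] cuts each box of a cover into two boxes whose
    volumes add up; clamping the height to the box makes this uniform. *)
Lemma measurable_halfspace_le i (c : R) :
  lebesgue_measurable [set x : V | x 0 i <= c].
Proof.
apply: le_caratheodory_measurable => X; apply: lebesgue_Rd_ge => a b cov.
have [ab Xab] := cov.
(* [c] clamped to the [i]-th side of the [k]-th box. *)
pose t k := Num.max (a k 0 i) (Num.min (b k 0 i) c).
have at_ k : a k 0 i <= t k by rewrite le_max lexx.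
have tb k : t k <= b k 0 i by rewrite ge_max ab ge_min lexx.
pose u k := row_with (b k) i (t k); pose l k := row_with (a k) i (t k).
have covu : box_cover (X `&` [set x : V | x 0 i <= c]) a u.
  split => [k j|x [/Xab[k _ xk] /= xc]].
    by rewrite mxE; case: eqP => [->|_].
  exists k => // j; have /andP[ax xb] := xk j; rewrite mxE ax /=.
  by case: eqP => // ji; subst j; rewrite le_max !le_min xb xc orbT.
have covl : box_cover (X `&` ~` [set x : V | x 0 i <= c]) l b.
  split => [k j|x [/Xab[k _ xk] /= /negP]].
    by rewrite mxE; case: eqP => [->|_].
  rewrite -ltNge => cx.
  exists k => // j; have /andP[ax xb] := xk j; rewrite mxE xb andbT.
  by case: eqP => // ji; subst j; rewrite gt_max ax gt_min cx orbT.
apply: (le_trans (leeD (le_lebesgue_Rd covu) (le_lebesgue_Rd covl))).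
rewrite -nneseriesD; first last.
- by move=> k _ _; exact: box_cover_vol_ge0 covl k.
- by move=> k _ _; exact: box_cover_vol_ge0 covu k.
by under eq_eseriesr do rewrite -EFinD -box_volume_split.
Qed.

Lemma measurable_halfspace_lt i (c : R) :
  lebesgue_measurable [set x : V | x 0 i < c].
Proof.
rewrite (_ : [set x | _] = \bigcup_n [set x : V | x 0 i <= c - n.+1%:R^-1]).
  by rewrite lebesgue_measurableE; apply: bigcupT_measurable => n;
    exact: measurable_halfspace_le.
apply/seteqP; split => [x /= xc|x [n _ /=] h]; last first.
  by apply: (le_lt_trans h); rewrite ltrBlDr ltrDl invr_gt0.
have /ltr_add_invr[n] := xc => h; exists n => //=.
by rewrite lerBrDr ltW.
Qed.

Lemma measurable_row_forall (D : 'I_d.+1 -> set V) :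
  (forall i, lebesgue_measurable (D i)) ->
  lebesgue_measurable [set x | forall i, D i x].
Proof.
move=> mD; rewrite (_ : [set x | _] = \bigcap_(i in setT) D i).
  by rewrite lebesgue_measurableE; apply: fin_bigcap_measurable => // i _; exact: mD.
by apply/seteqP; split => [x h i _|x h i]; exact: h.
Qed.

Lemma measurable_box a b : lebesgue_measurable (box a b).
Proof.
apply: (@measurable_row_forall (fun i => [set x | a 0 i < x 0 i <= b 0 i])) => i.
rewrite (_ : [set x | _] =
    [set x | x 0 i <= b 0 i] `\` [set x | x 0 i <= a 0 i]).
  by rewrite lebesgue_measurableE; apply: measurableD; exact: measurable_halfspace_le.
apply/seteqP; split => [x /= /andP[ax xb]|x /= [xb /negP]].
  by split => //; apply/negP; rewrite -ltNge.
by rewrite -ltNge xb => ->.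
Qed.

Lemma measurable_cube x (s : R) : lebesgue_measurable (cube x s).
Proof.
apply: (@measurable_row_forall (fun i => [set y | `|y 0 i - x 0 i| < s / 2])) => i.
rewrite (_ : [set y | _] = [set y | y 0 i < x 0 i + s / 2] `\`
    [set y | y 0 i <= x 0 i - s / 2]).
  rewrite lebesgue_measurableE; apply: measurableD.
    exact: measurable_halfspace_lt.
  exact: measurable_halfspace_le.
apply/seteqP; split => [y /=|y /= [yl /negP]].
  by rewrite ltr_norml => /andP[? ?]; split; [lra|apply/negP; lra].
by rewrite -ltNge ltr_norml => ?; apply/andP; split; lra.
Qed.

End measurable_sets.

Section affine.
Context {R : realType} {d : nat}.
Notation V := 'rV[R]_d.+1.
Implicit Types (a b x y : V) (A B : set V) (t : R).

(** Translations and dilations together, so that invariance and homogeneity are a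
    single statement. *)
Definition affine t y A : set V := [set t *: x + y | x in A].

Lemma translate_affine y A : translate y A = affine 1 y A.
Proof. by apply: eq_imagel => x _; rewrite scale1r. Qed.

Lemma dilate_affine t A : dilate t A = affine t 0 A.
Proof. by apply: eq_imagel => x _; rewrite addr0. Qed.

Lemma affineE t y A : 0 < t -> affine t y A = [set x | A (t^-1 *: (x - y))].
Proof.
move=> t0; have tu : t \is a GRing.unit by rewrite unitfE gt_eqF.
apply/seteqP; split => [_ [x Ax <-] /=|x /= Ax].
  by rewrite addrK scalerA mulVr ?scale1r.
by exists (t^-1 *: (x - y)) => //; rewrite scalerA divrr ?scale1r// subrK.
Qed.

Lemma affineK t y A : 0 < t -> affine t^-1 (- (t^-1 *: y)) (affine t y A) = A.
Proof.
move=> t0; have tu : t \is a GRing.unit by rewrite unitfE gt_eqF.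
have E x : t^-1 *: (t^-1^-1 *: (x - - (t^-1 *: y)) - y) = x.
  by rewrite invrK opprK (scalerDr t) !(scalerA t) divrr// scale1r addrK
    scalerA mulVr// scale1r.
by rewrite !affineE ?invr_gt0//; apply/seteqP; split => x /=; rewrite E.
Qed.

Let lebesgue_affine_le t y A : 0 < t ->
  (lebesgue_Rd (affine t y A) <= (t ^+ d.+1)%:E * lebesgue_Rd A)%E.
Proof.
move=> t0; rewrite muleC -lee_pdivrMr ?exprn_gt0//; apply: lebesgue_Rd_ge => a b cov.
have [ab Aab] := cov; rewrite lee_pdivrMr ?exprn_gt0// muleC.
rewrite -nneseriesZl; last by move=> k _; exact: box_cover_vol_ge0 cov k.
have cov' : box_cover (affine t y A) (fun k => t *: a k + y) (fun k => t *: b k + y).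
  split => [k i|_ [x /Aab[k _ xk] <-]]; first by rewrite !mxE lerD2r ler_pM2l.
  by exists k => // i; rewrite !mxE ltrD2r lerD2r ltr_pM2l// ler_pM2l.
apply: (le_trans (le_lebesgue_Rd cov')); rewrite le_eqVlt; apply/orP; left; apply/eqP.
apply: eq_eseriesr => k _; rewrite -EFinM; congr EFin.
rewrite /box_volume (_ : t ^+ d.+1 = \prod_(i < d.+1) t); last first.
  by rewrite prodr_const card_ord.
by rewrite -big_split/=; apply: eq_bigr => i _; rewrite !mxE; ring.
Qed.

(** One inequality comes from transporting covers by boxes; the other is the same
    inequality for the inverse map. *)
Lemma lebesgue_affine t y A : 0 < t ->
  lebesgue_Rd (affine t y A) = ((t ^+ d.+1)%:E * lebesgue_Rd A)%E.
Proof.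
move=> t0; apply/eqP; rewrite eq_le lebesgue_affine_le//=.
have tV : 0 < t^-1 by rewrite invr_gt0.
have := lebesgue_affine_le (- (t^-1 *: y)) (affine t y A) tV.
rewrite affineK// exprVn => h.
by rewrite muleC -lee_pdivlMr ?exprn_gt0// muleC.
Qed.

Lemma measurable_affine t y A : 0 < t ->
  lebesgue_measurable A -> lebesgue_measurable (affine t y A).
Proof.
move=> t0 mA X; have tV : 0 < t^-1 by rewrite invr_gt0.
set X' := affine t^-1 (- (t^-1 *: y)) X.
have XE : X = affine t y X'.
  by rewrite -(affineK (- (t^-1 *: y)) X tV) -/X' invrK scalerN opprK scalerA
    mulfV ?gt_eqF// scale1r.
clearbody X'.
have IE B : X `&` affine t y B = affine t y (X' `&` B).
  by rewrite {1}XE !affineE.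
have CE : ~` affine t y A = affine t y (~` A) by rewrite !affineE.
rewrite CE !IE {1}XE !lebesgue_affine// -muleDr//; last first.
  by apply: ge0_adde_def; rewrite inE lebesgue_Rd_ge0.
by rewrite -(mA X').
Qed.

End affine.

Section cube_volume.
Context {R : realType} {d : nat}.
Notation V := 'rV[R]_d.+1.
Implicit Types (a b x y : V) (A B : set V) (s : R).

Definition halfopen_cube x s : set V := box x (x + const_mx s).

Definition cube_unit : R := fine (lebesgue_Rd (cube (0 : V) 1)).

Definition cube_vol s : R := cube_unit * s ^+ d.+1.

Lemma cube_affine x s : 0 < s -> cube x s = affine s x (cube 0 1).
Proof.
move=> s0; rewrite affineE//; apply/seteqP; split => y /= h i; have := h i;
  rewrite !mxE subr0 normrM gtr0_norm ?invr_gt0// (mulrC s^-1) ltr_pdivrMr//;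
  by rewrite div1r mulrC.
Qed.

Lemma cube_le_volume x s : 0 < s -> (lebesgue_Rd (cube x s) < +oo)%E.
Proof.
move=> s0; pose r : V := const_mx (s / 2).
apply: (@le_lt_trans _ _ (lebesgue_Rd (box (x - r) (x + r)))).
  apply: lebesgue_Rd_le => y h i; have := h i; rewrite !mxE ltr_norml => ?.
  by apply/andP; split; lra.
apply: (@le_lt_trans _ _ (box_volume (x - r) (x + r))%:E); last exact: ltey.
apply: lebesgue_Rd_box_le => i; rewrite !mxE; lra.
Qed.

Lemma lebesgue_cube x s : 0 < s ->
  lebesgue_Rd (cube x s) = (cube_vol s)%:E.
Proof.
move=> s0; rewrite cube_affine// lebesgue_affine// /cube_vol EFinM muleC /cube_unit fineK//.
by rewrite ge0_fin_numE ?lebesgue_Rd_ge0//; exact: cube_le_volume.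
Qed.

(** A half-open cube is caught between the open cube of the same side and the
    slightly larger ones, whose volumes converge by homogeneity. *)
Lemma lebesgue_halfopen_cube x s : 0 < s ->
  lebesgue_Rd (halfopen_cube x s) = (cube_vol s)%:E.
Proof.
move=> s0; pose z : V := x + const_mx (s / 2).
apply/eqP; rewrite eq_le; apply/andP; split; last first.
  rewrite -(lebesgue_cube z)//; apply: lebesgue_Rd_le => y h i; have := h i.
  by rewrite !mxE ltr_norml => ?; apply/andP; split; lra.
have up (e : R) : 0 < e ->
    (lebesgue_Rd (halfopen_cube x s) <= (cube_vol (s + e))%:E)%E.
  move=> e0; rewrite -(lebesgue_cube z) ?addr_gt0//.
  apply: lebesgue_Rd_le => y h i; have := h i.
  by rewrite !mxE ltr_norml => ?; apply/andP; split; lra.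
have fin : lebesgue_Rd (halfopen_cube x s) \is a fin_num.
  by rewrite ge0_fin_numE ?lebesgue_Rd_ge0// (le_lt_trans (up 1 ltr01)) ?ltey.
rewrite -(fineK fin) lee_fin.
have cvg : (fun e => cube_unit * (s + e) ^+ d.+1) @ 0^'+ --> cube_unit * s ^+ d.+1.
  apply: cvg_at_right_filter.
  rewrite [X in _ --> X](_ : _ = cube_unit * (s + 0) ^+ d.+1); last by rewrite addr0.
  apply: cvgM; first exact: cvg_cst.
  apply: (@cvg_comp _ _ _ (fun e => s + e) (fun u => u ^+ d.+1)).
    by apply: cvgD; [exact: cvg_cst|exact: cvg_id].
  exact: exprn_continuous.
rewrite -[cube_vol s](cvg_lim _ cvg)//; apply: limr_ge; first exact: cvgP cvg.
near=> e; have := up e; rewrite -{1}(fineK fin) lee_fin.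
by apply.
Unshelve. all: by end_near. Qed.

End cube_volume.

(** * Finite unions, rounding and distances *)

Section elementary.
Context {R : realType}.
Implicit Types (r s D e : R).

(** Adding a fixed gap [D] to the side of a large cube changes its volume by a
    factor close to one. *)
Lemma expr_shift_le (k : nat) D e : 0 <= D -> 0 < e ->
  exists2 s0, 0 < s0 & forall s, s0 <= s -> (s + D) ^+ k <= (1 + e) * s ^+ k.
Proof.
move=> D0; elim: k e => [|k IH] e e0.
  by exists 1 => // s _; rewrite !expr0; lra.
have [u [u0 u1 ue]] : exists u, [/\ 0 < u, u <= 1 & 3 * u <= e].
  by exists (Num.min 1 (e / 3)); split;
    rewrite ?lt_min ?ge_min ?lexx ?ltr01 ?divr_gt0//;
    rewrite mulrC -ler_pdivlMr// ge_min lexx orbT.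
have [s0 s00 h] := IH u u0.
exists (s0 + D / u) => [|s]; first by rewrite ltr_pwDl// divr_ge0// ltW.
have Du : 0 <= D / u by rewrite divr_ge0// ltW.
move=> ss; have s0s : s0 <= s by lra.
have Ds : D <= u * s by rewrite -ler_pdivrMl// mulrC; lra.
have s_ge0 : 0 < s by lra.
rewrite !exprS; apply: (@le_trans _ _ ((1 + u) * s * ((1 + u) * s ^+ k))).
  apply: ler_pM => //; [lra|by rewrite exprn_ge0//; lra|lra|exact: h].
rewrite mulrACA (_ : s * s ^+ k = s ^+ k.+1) ?exprS// -exprS.
apply: ler_wpM2r; first by rewrite exprn_ge0// ltW.
by nra.
Qed.

Lemma expr_shift_ge (k : nat) D e : 0 <= D -> 0 < e ->
  exists2 s0, 0 < s0 & forall s, s0 <= s -> D < s /\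
    (1 - e) * s ^+ k <= (s - D) ^+ k.
Proof.
move=> D0 e0; have [s0 s00 h] := expr_shift_le k D0 e0.
exists (s0 + D) => [|s ss]; first lra.
split; first lra.
have := h (s - D); rewrite subrK => /(_ _)/wrap[]; first lra.
move=> hs; have sD : 0 <= (s - D) ^+ k by rewrite exprn_ge0//; lra.
have sk : 0 <= s ^+ k by rewrite exprn_ge0//; lra.
nra.
Qed.

(** Rounding down to an odd multiple of [p]: the odd numbers are the side lengths,
    in tiles, of the blocks of tiles centred at a tile. *)
Lemma odd_multiple_le p r : 0 < p -> p <= r ->
  exists n : nat, n.*2.+1%:R * p <= r < n.*2.+1%:R * p + 2 * p.
Proof.
move=> p0 pr; pose x := (r / p - 1) / 2.
have x0 : 0 <= x by rewrite divr_ge0// subr_ge0 ler_pdivlMr// mul1r.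
have /andP[l u] := truncn_itv x0; exists (Num.truncn x).
have rE : r = (2 * x + 1) * p.
  rewrite /x mulrC (mulrCA 2) divff// mulr1 subrK mulrCA divff ?mulr1//.
  by rewrite gt_eqF.
move: l u; set n := Num.truncn x => l u.
have -> : n.*2.+1%:R = 2 * n%:R + 1 :> R by rewrite -addn1 natrD -mul2n natrM.
rewrite -addn1 natrD in u; rewrite rE -mulrDl ler_pM2r// ltr_pM2r//.
by apply/andP; split; lra.
Qed.

Lemma sume_const (I : finType) (x : \bar R) : (0 <= x)%E ->
  (\sum_(i : I) x = #|I|%:R%:E * x)%E.
Proof.
move=> x0; rewrite big_const; elim: #|I| => [|n IH]; first by rewrite mul0e.
by rewrite iterS IH -natr1 addrC EFinD ge0_muleDl ?lee_fin// mul1e.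
Qed.

End elementary.

Section euclidean.
Context {R : realType} {d : nat}.
Implicit Types x y : 'rV[R]_d.

Lemma coord_le_euclidean_dist x y i :
  `|x 0 i - y 0 i| <= euclidean_dist x y.
Proof.
rewrite -sqrtr_sqr ler_wsqrtr// (bigD1 i)//= lerDl.
by apply: sumr_ge0 => j _; exact: sqr_ge0.
Qed.

End euclidean.

Section finite_unions.
Context {R : realType} {d : nat}.
Notation V := 'rV[R]_d.+1.

Lemma lebesgue_bigcup_fin (I : finType) (Q : pred I) (F : I -> set V) :
  (forall i, Q i -> lebesgue_measurable (F i)) -> trivIset [set` Q] F ->
  lebesgue_Rd (\bigcup_(i in [set` Q]) F i) =
  (\sum_(i | Q i) lebesgue_Rd (F i))%E.
Proof.
move=> mF tF; rewrite -lebesgueE (measure_fin_bigcup (lebesgue R d))//.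
rewrite (_ : [set` Q] = [set` enum Q]).
  by rewrite -fsbig_seq ?enum_uniq// big_enum.
by apply/seteqP; split => i /=; rewrite mem_enum.
Qed.

Lemma lebesgue_measurable0 : lebesgue_measurable (set0 : set V).
Proof. exact: (@measurable0 _ (caratheodory_type (@lebesgue_Rd R d.+1))). Qed.

Lemma lebesgue_measurableI (A B : set V) :
  lebesgue_measurable A -> lebesgue_measurable B -> lebesgue_measurable (A `&` B).
Proof. exact: caratheodory_measurable_setI. Qed.

Lemma lebesgue_measurableD (A B : set V) :
  lebesgue_measurable A -> lebesgue_measurable B -> lebesgue_measurable (A `\` B).
Proof. exact: caratheodory_measurable_setD. Qed.

Lemma lebesgue_setU_disj (A B : set V) :
  lebesgue_measurable A -> lebesgue_measurable B -> A `&` B = set0 ->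
  lebesgue_Rd (A `|` B) = (lebesgue_Rd A + lebesgue_Rd B)%E.
Proof. exact: (measureU (lebesgue R d)). Qed.

Lemma lebesgue_measurable_bigcup (I : countType) (F : I -> set V) :
  (forall i, lebesgue_measurable (F i)) ->
  lebesgue_measurable (\bigcup_i F i).
Proof.
move=> mF.
exact: (@countable_bigcupT_measurable _ (caratheodory_type (@lebesgue_Rd R d.+1))).
Qed.

End finite_unions.

(** * Properties determined at a bounded distance *)

Section local_property.
Context {R : realType} {d : nat}.
Notation V := 'rV[R]_d.+1.
Implicit Types (P : set V -> bool) (A B E : set V) (D : R).

(** What a boundedly finite supersaturable property retains: membership can be
    tested separately on pieces at mutual distance at least [D]. *)
Record local_property D P : Prop := LocalProperty {
  local_gap_gt0 : 0 < D;
  local_sub : forall A B, lebesgue_measurable A -> lebesgue_measurable B ->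
    B `<=` A -> P A -> P B;
  local_translate : forall A x, lebesgue_measurable A -> P A ->
    P (translate x A);
  local_bigcup : forall (I : countType) (F : I -> set V),
    (forall i, lebesgue_measurable (F i)) -> (forall i, P (F i)) ->
    (forall i j, i != j -> far_apart D (F i) (F j)) -> P (\bigcup_i F i)
}.

(** A forbidden set is finite, so it meets only finitely many pieces, and finite
    unions are handled one piece at a time by the diameter condition. *)
Lemma local_property_of_supersaturable P :
  boundedly_finite P -> supersaturable P -> exists D, local_property D P.
Proof.
move=> [Fam [Fam_fin _ PFam]] [sat satP].
have sub A B : lebesgue_measurable A -> lebesgue_measurable B ->
    B `<=` A -> P A -> P B.
  by move=> mA mB BA; have [_] := sat_monotone satP mA mB BA.
have P0 : P set0.
  have [_ [A [mA PA] _] _] := ereal_sup_gt (sat_max_density_gt0 satP).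
  by apply: (sub A) => //; exact: lebesgue_measurable0.
have [D0 far] := sat_diam satP.
exists (Num.max D0 1); split => //.
- by rewrite lt_max ltr01 orbT.
- by move=> A x mA PA; have [->] := sat_translate satP x mA.
move=> I F mF PF Ffar.
have finU s : uniq s -> lebesgue_measurable (\big[setU/set0]_(i <- s) F i) /\
    P (\big[setU/set0]_(i <- s) F i).
  elim: s => [_|i s IH /= /andP[is_ us]].
    rewrite big_nil; split => //.
    exact: lebesgue_measurable0.
  have [ms Ps] := IH us; rewrite big_cons; split.
    by apply: (@measurableU _ (caratheodory_type (@lebesgue_Rd R d.+1))) => //; exact: mF.
  have [|_ [_ ->//]] := far _ _ (mF i) ms.
  rewrite -bigcup_seq => x y Fx [j /= js Fy].
  have ij : i != j by apply: contraNneq is_ => ->.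
  by apply: le_trans (Ffar _ _ ij _ _ Fx Fy); rewrite le_max lexx.
apply/(PFam _ (lebesgue_measurable_bigcup mF)) => -[S FamS SF].
have [x0 Sx0] : S !=set0.
  apply/set0P/eqP => S0; apply: (PFam set0 lebesgue_measurable0).1 => //.
  by exists S => //; rewrite S0.
have [i0 _ _] := SF _ Sx0.
have [f Ff] : {f : V -> I & forall x, S x -> F (f x) x}.
  apply: (@choice _ _ (fun x i => S x -> F i x)) => x.
  have [/SF[i _ Fi]|] := pselect (S x); first by exists i.
  by exists i0.
have /finite_seqP[xs Sxs] := Fam_fin _ FamS.
pose s := undup [seq f x | x <- xs].
have [ms] := finU s (undup_uniq _).
move=> /(PFam _ ms); apply; exists S => // x Sx.
rewrite -bigcup_seq; exists (f x); last exact: Ff.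
rewrite /= mem_undup; apply: map_f.
by move: Sx; rewrite Sxs.
Qed.

End local_property.

Section periodic_copies.
Context {R : realType} {d : nat}.
Notation V := 'rV[R]_d.+1.
Implicit Types (P : set V -> bool) (A B E : set V) (D : R).

(** The copies are centred at the nodes of the lattice of period [s + D], which
    leaves gaps of width [D] between them; the cube of side [(2n + 1) (s + D)]
    contains the [(2n + 1) ^ d] copies with coordinates between [-n] and [n]. *)
Lemma periodic_copies D P A (s : R) : local_property D P ->
  lebesgue_measurable A -> P A -> (forall x i, A x -> `|x 0 i| <= s / 2) ->
  exists E, [/\ lebesgue_measurable E, P E &
    forall (n : nat) r, n.*2.+1%:R * (s + D) <= r ->
      ((n.*2.+1%:R ^+ d.+1)%:E * lebesgue_Rd A <= lebesgue_Rd (E `&` cube 0 r))%E].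
Proof.
move=> locP mA PA As; have D0 := local_gap_gt0 locP.
pose node (z : {ffun 'I_d.+1 -> int}) : V := (s + D) *: \row_i (z i)%:~R.
pose F z := translate (node z) A.
have mF z : lebesgue_measurable (F z).
  by rewrite /F translate_affine; exact: measurable_affine.
have FarF z z' : z != z' -> far_apart D (F z) (F z').
  move=> zz' _ _ [a Aa <-] [b Ab <-].
  have /existsP[i zi] : [exists i, z i != z' i].
    apply: contraNT zz' => /existsPn h; apply/eqP/ffunP => i; apply/eqP.
    by rewrite -[_ == _]negbK.
  apply: le_trans (coord_le_euclidean_dist _ _ i); rewrite !mxE.
  have ai := As _ i Aa; have bi := As _ i Ab.
  set u := a 0 i in ai *; set v := b 0 i in bi *.
  have s0 : 0 <= s by have := normr_ge0 u; lra.
  have zz1 : 1 <= `|(z i)%:~R - (z' i)%:~R| :> R.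
    by rewrite -intrB -intr_norm ler1z -gtz0_ge1 normr_gt0 subr_eq0.
  have sD : s + D <= `|(s + D) * ((z i)%:~R - (z' i)%:~R)|.
    by rewrite normrM gtr0_norm ?ler_peMr//; lra.
  have -> : u + (s + D) * (z i)%:~R - (v + (s + D) * (z' i)%:~R) =
      (s + D) * ((z i)%:~R - (z' i)%:~R) - (v - u) by ring.
  apply: le_trans (lerB_dist _ _).
  have := ler_normB v u; lra.
exists (\bigcup_z F z); split.
- exact: lebesgue_measurable_bigcup.
- by apply: (local_bigcup locP) => // z; exact: (local_translate locP).
move=> n r nr.
pose z (k : {ffun 'I_d.+1 -> 'I_n.*2.+1}) : {ffun 'I_d.+1 -> int} :=
  [ffun i => (k i)%:Z - n%:Z].
have zinj : injective z.
  move=> k k' /ffunP h; apply/ffunP => i; apply/val_inj.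
  by have := h i; rewrite !ffunE => /addIr [].
have := @lebesgue_bigcup_fin R d _ xpredT (F \o z) (fun k _ => mF (z k)).
move=> /(_ _)/wrap[].
  move=> k k' _ _ [x [/= Fx Fx']]; apply: zinj; apply/eqP/negPn/negP => kk'.
  have := FarF _ _ kk' _ _ Fx Fx'.
  rewrite /euclidean_dist big1 ?sqrtr0 => [|i _]; last by rewrite subrr expr0n.
  by rewrite leNgt D0.
rewrite (eq_bigr (fun=> lebesgue_Rd A)) => [h|k _]; last first.
  by rewrite /= /F translate_affine lebesgue_affine// expr1n mul1e.
have -> : ((n.*2.+1%:R ^+ d.+1)%:E * lebesgue_Rd A =
    lebesgue_Rd (\bigcup_(k in [set` xpredT]) (F \o z) k))%E.
  by rewrite h sume_const ?lebesgue_Rd_ge0// card_ffun !card_ord natrX.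
apply: lebesgue_Rd_le => _ [k _ [a Aa <-]]; split.
  by exists (z k) => //; exists a.
move=> i; rewrite !mxE subr0 ffunE rmorphB/= -!pmulrn.
have ai := As _ i Aa; set u := a 0 i in ai *.
have kn : ((k i)%:R : R) <= 2 * n%:R.
  by rewrite -natrM ler_nat mul2n -ltnS; exact: ltn_ord.
have k0 : 0 <= (k i)%:R :> R by exact: ler0n.
have s0 : 0 <= s by have := normr_ge0 u; lra.
have nE : n.*2.+1%:R = 2 * n%:R + 1 :> R by rewrite -addn1 natrD -mul2n natrM.
rewrite nE in nr; set w : R := (k i)%:R - n%:R.
have wn : `|(s + D) * w| <= (s + D) * n%:R.
  rewrite normrM gtr0_norm ?ler_pM2l//; [|lra|lra].
  by rewrite ler_norml /w; apply/andP; split; lra.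
apply: le_lt_trans (ler_normD _ _) _; lra.
Qed.

End periodic_copies.

(** * Densities in cubes *)

Section density.
Context {R : realType} {d : nat}.
Notation V := 'rV[R]_d.+1.
Notation vol := (@cube_vol R d).
Implicit Types (P : set V -> bool) (A B E : set V) (D l r s v : R).

Lemma densityE Omega A v : lebesgue_Rd Omega = v%:E -> 0 < v ->
  density Omega A = (lebesgue_Rd (A `&` Omega) * (v^-1)%:E)%E.
Proof. by move=> e v0; rewrite /density e inver gt_eqF. Qed.

Lemma cube_unit_ge0 : 0 <= @cube_unit R d.
Proof. by apply: fine_ge0; exact: lebesgue_Rd_ge0. Qed.

(** Were the unit cube null, then so would be every cube, and all the densities
    would vanish. *)
Lemma cube_unit_gt0 P : (0 < max_density P)%E -> 0 < @cube_unit R d.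
Proof.
move=> m0; rewrite lt_def cube_unit_ge0 andbT; apply: contraPneq m0 => c0.
apply/negP; rewrite -leNgt; apply: ge_ereal_sup => _ [A _ <-].
apply: (@le_trans _ _ (ereal_sup
    ((fun r => density (cube (0 : V) r) A) @` [set r | 0 < r]))).
  apply: ereal_inf_lbound; exists [set r | 0 < r] => //.
  by exists 0; split => // x; rewrite num_real.
apply: ge_ereal_sup => _ [r /= r0 <-]; rewrite /density.
rewrite (_ : lebesgue_Rd (A `&` cube 0 r) = 0%E) ?mul0e//.
apply/eqP; rewrite eq_le lebesgue_Rd_ge0 andbT.
by rewrite (le_trans (lebesgue_Rd_le (@subIsetr _ _ _)))// lebesgue_cube// /cube_vol c0 mul0r.
Qed.

Section positive_unit.
Context (c0 : 0 < @cube_unit R d).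

Lemma cube_vol_gt0 r : 0 < r -> 0 < vol r.
Proof. by move=> r0; rewrite mulr_gt0// exprn_gt0. Qed.

Lemma density_cube_gt l x r A : 0 < r ->
  (l%:E < density (cube x r) A)%E =
  ((l * vol r)%:E < lebesgue_Rd (A `&` cube x r))%E.
Proof.
move=> r0; have v0 := cube_vol_gt0 r0.
by rewrite (densityE _ (lebesgue_cube x r0))// lte_pdivlMr.
Qed.

Lemma upper_density_ge (l : \bar R) A :
  (forall r0 : R, exists2 r, r0 <= r & (l <= density (cube 0 r) A)%E) ->
  (l <= upper_density A)%E.
Proof.
move=> h; apply: le_ereal_inf_tmp => _ [W [M [_ MW]] <-].
have [r Mr lr] := h (M + 1); apply: (le_trans lr).
by apply: ereal_sup_ubound; exists r => //; apply: MW; lra.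
Qed.

Lemma upper_density_gt (l : \bar R) A r0 : (l < upper_density A)%E ->
  exists2 r, r0 < r & (l < density (cube 0 r) A)%E.
Proof.
move=> lA; apply: contrapT => h; move: lA; apply/negP; rewrite -leNgt.
apply: (@le_trans _ _ (ereal_sup
    ((fun r => density (cube (0 : V) r) A) @` [set r | r0 < r]))).
  apply: ereal_inf_lbound; exists [set r | r0 < r] => //.
  by exists r0; split => //; rewrite num_real.
apply: ge_ereal_sup => _ [r /= r0r <-]; rewrite leNgt; apply/negP => lr.
by apply: h; exists r.
Qed.

Lemma max_density_le1 P : (max_density P <= 1)%E.
Proof.
apply: ge_ereal_sup => _ [A _ <-]; rewrite leNgt; apply/negP.
move=> /(upper_density_gt 0)[r r0]; rewrite density_cube_gt// mul1r.
apply/negP; rewrite -leNgt -(lebesgue_cube 0)//.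
by apply: lebesgue_Rd_le; exact: subIsetr.
Qed.

Context (P : set V -> bool) (D : R) (locP : local_property D P).
Context (m : R) (Pm : max_density P = m%:E) (m0 : 0 < m).

Let m1 : m <= 1.
Proof. by have := max_density_le1 P; rewrite Pm lee_fin. Qed.

(** Repeating a piece that fits in a cube of side [s] with period [s + D] yields
    a set with the property, hence of upper density at most [m]; for large [s]
    the gap [D] is negligible. *)
Lemma lebesgue_le_max_density e : 0 < e -> exists2 s0, 0 < s0 &
  forall s A (x : V), s0 <= s -> lebesgue_measurable A -> P A ->
    (forall y i, A y -> `|y 0 i - x 0 i| <= s / 2) ->
    (lebesgue_Rd A <= ((m + e) * vol s)%:E)%E.
Proof.
move=> e0; have D0 := local_gap_gt0 locP.
have [s0 s00 hs0] := expr_shift_le d.+1 (ltW D0) e0.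
exists s0 => // s A x ss mA PA As; have sgt0 : 0 < s by lra.
have mA' : lebesgue_measurable (translate (- x) A).
  by rewrite translate_affine; exact: measurable_affine.
have PA' := local_translate locP (- x) mA PA.
have As' (y : V) i : translate (- x) A y -> `|y 0 i| <= s / 2.
  by move=> [a Aa <-]; rewrite !mxE; exact: As.
have [E [mE PE hE]] := periodic_copies locP mA' PA' As'.
have A'A : lebesgue_Rd (translate (- x) A) = lebesgue_Rd A.
  by rewrite translate_affine lebesgue_affine// expr1n mul1e.
have Em : (upper_density E <= m%:E)%E.
  by rewrite -Pm; apply: ereal_sup_ubound; exists E.
have sD : 0 < s + D by lra.
have vD := cube_vol_gt0 sD.
suff : (lebesgue_Rd A * ((vol (s + D))^-1)%:E <= m%:E)%E.
  rewrite lee_pdivrMr// => /le_trans; apply; rewrite -EFinM lee_fin /cube_vol.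
  rewrite !(mulrCA _ (@cube_unit R d)) ler_pM2l//.
  have sk : 0 < s ^+ d.+1 by rewrite exprn_gt0.
  apply: le_trans (ler_wpM2l (ltW m0) (hs0 _ ss)) _.
  rewrite mulrA; apply: ler_wpM2r; [exact: ltW|have := m1; nra].
apply: le_trans Em; apply: upper_density_ge => r0.
have [n r0n] : exists n : nat, r0 <= n.*2.+1%:R * (s + D).
  exists (Num.truncn (r0 / (s + D))).
  rewrite -ler_pdivrMr//; apply: le_trans (ltW (truncnS_gt _)) _.
  by rewrite ler_nat ltnS -addnn leq_addr.
exists (n.*2.+1%:R * (s + D)) => //.
have r0' : 0 < n.*2.+1%:R * (s + D) by rewrite mulr_gt0.
rewrite (densityE _ (lebesgue_cube 0 r0')) ?cube_vol_gt0//.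
rewrite lee_pdivlMr ?cube_vol_gt0//; apply: le_trans (hE _ _ (lexx _)).
have -> : vol (n.*2.+1%:R * (s + D)) = n.*2.+1%:R ^+ d.+1 * vol (s + D).
  by rewrite /cube_vol exprMn mulrCA.
by rewrite A'A -muleA -EFinM mulrCA mulVf ?gt_eqF// mulr1 muleC.
Qed.

(** A set with the property that is dense in one huge cube becomes, by repetition,
    dense in all large cubes: this replaces an upper density by a lower one. *)
Lemma dense_in_large_cubes e : 0 < e -> exists E r0,
  [/\ lebesgue_measurable E, P E & forall r, r0 <= r ->
    (((m - e) * vol r)%:E <= lebesgue_Rd (E `&` cube 0 r))%E].
Proof.
move=> e0; have D0 := local_gap_gt0 locP.
pose u := Num.min m (e / 3).
have um : u <= m by rewrite ge_min lexx.
have ue : 3 * u <= e by rewrite mulrC -ler_pdivlMr// ge_min lexx orbT.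
have u0 : 0 < u by rewrite lt_min m0 divr_gt0.
clearbody u; have : ((m - u)%:E < max_density P)%E by rewrite Pm lte_fin; lra.
move=> /ereal_sup_gt[_ [A [mA PA] <-] mA_].
have [s0 s00 hs0] := expr_shift_le d.+1 (ltW D0) u0.
have [s s0s] := upper_density_gt s0 mA_; have sgt0 : 0 < s by lra.
rewrite density_cube_gt// => /ltW As.
set A0 := A `&` cube 0 s in As.
have mA0 : lebesgue_measurable A0.
  by apply: lebesgue_measurableI => //; exact: measurable_cube.
have PA0 : P A0 by apply: (local_sub locP mA mA0) => // y [].
have A0s (y : V) i : A0 y -> `|y 0 i| <= s / 2.
  by move=> [_ /(_ i)]; rewrite mxE subr0 => /ltW.
have [E [mE PE hE]] := periodic_copies locP mA0 PA0 A0s.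
have p0 : 0 < s + D by lra.
have p20 : 0 <= 2 * (s + D) by lra.
have [r0 r00 hr0] := expr_shift_ge d.+1 p20 u0.
exists E, r0; split => // r rr0.
have [rp rpk] := hr0 _ rr0; have sp := hs0 _ (ltW s0s).
have [||n /andP[nr rn]] := @odd_multiple_le _ (s + D) r => //; first by lra.
apply: le_trans (hE _ _ nr).
apply: (@le_trans _ _ ((n.*2.+1%:R ^+ d.+1)%:E * ((m - u) * vol s)%:E)%E); last first.
  apply: lee_pmul => //; rewrite lee_fin ?exprn_ge0//.
  by rewrite mulr_ge0 ?(ltW (cube_vol_gt0 _))//; lra.
rewrite -EFinM lee_fin /cube_vol !(mulrCA _ (@cube_unit R d)) ler_pM2l//.
have npk : (r - 2 * (s + D)) ^+ d.+1 <= n.*2.+1%:R ^+ d.+1 * (s + D) ^+ d.+1.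
  by rewrite -exprMn lerXn2r ?nnegrE//; [lra|rewrite mulr_ge0//; lra|lra].
set X := r ^+ d.+1 in rpk *; set Y := (s + D) ^+ d.+1 in sp npk.
set Z := s ^+ d.+1 in sp *; set N := n.*2.+1%:R ^+ d.+1 in npk *.
have N0 : 0 <= N by rewrite exprn_ge0.
have Z0 : 0 <= Z by rewrite exprn_ge0// ltW.
have X0 : 0 <= X by rewrite exprn_ge0//; lra.
have h1 : (1 - u) * X <= (1 + u) * (N * Z).
  apply: le_trans rpk _; apply: le_trans npk _.
  by rewrite mulrCA ler_wpM2l.
have : (1 - 2 * u) * X <= N * Z.
  have : (1 + u) * ((1 - 2 * u) * X) <= (1 + u) * (N * Z) by apply: le_trans h1; nra.
  by rewrite ler_pM2l//; lra.
rewrite mulrCA => h2.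
have : (m - u) * ((1 - 2 * u) * X) <= (m - u) * (N * Z) by apply: ler_wpM2l => //; lra.
apply: le_trans; rewrite mulrA; apply: ler_wpM2r => //.
by have := m1; nra.
Qed.

End positive_unit.
End density.

(** * A set of maximal density in centred cubes *)

Section gluing.
Context {R : realType} {d : nat}.
Notation V := 'rV[R]_d.+1.
Notation vol := (@cube_vol R d).
Implicit Types (A B E : set V) (r e : R).

Lemma far_apart_sym (D : R) A B : far_apart D A B -> far_apart D B A.
Proof.
move=> h x y Bx Ay; rewrite /euclidean_dist; under eq_bigr do rewrite -sqrrN opprB.
exact: h.
Qed.

Lemma far_apart_disj (D : R) A B : 0 < D -> far_apart D A B -> A `&` B = set0.
Proof.
move=> D0 h; apply/seteqP; split => // x [Ax Bx]; have := h _ _ Ax Bx.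
rewrite /euclidean_dist big1 ?sqrtr0 => [|i _]; last by rewrite subrr expr0n.
by rewrite leNgt D0.
Qed.

Lemma le_cube (x : V) r r' : r <= r' -> cube x r `<=` cube x r'.
Proof. by move=> rr y h i; apply: lt_le_trans (h i) _; rewrite ler_pM2r. Qed.

(** The parameters are side lengths, so the half-sides differ by [D]. *)
Lemma far_apart_shells (D r r' : R) A B : r + 2 * D <= r' ->
  far_apart D (A `&` cube 0 r) (B `\` cube 0 r').
Proof.
move=> rr x y [_ xr] [_ yr].
have [i yi] : exists i, r' / 2 <= `|y 0 i|.
  apply: contrapT => h; apply: yr => i; rewrite mxE subr0 ltNge; apply/negP => yi.
  by apply: h; exists i.
apply: le_trans (coord_le_euclidean_dist _ _ i).
have := xr i; rewrite mxE subr0 => xi.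
rewrite distrC; apply: le_trans (lerB_dist _ _); lra.
Qed.

Lemma lebesgue_setD_ge A B (a b : R) :
  lebesgue_measurable A -> lebesgue_measurable B ->
  (a%:E <= lebesgue_Rd A)%E -> (lebesgue_Rd (A `&` B) <= b%:E)%E ->
  ((a - b)%:E <= lebesgue_Rd (A `\` B))%E.
Proof.
move=> mA mB aA Bb; rewrite EFinB leeBlDr//; apply: (le_trans aA).
have -> : lebesgue_Rd A = (lebesgue_Rd (A `\` B) + lebesgue_Rd (A `&` B))%E.
  exact: (measureDI (lebesgue R d) mA mB).
by rewrite leeD2l.
Qed.

Lemma le_cube_vol r r' : 0 <= r -> r <= r' -> vol r <= vol r'.
Proof.
move=> r0 rr; apply: ler_wpM2l; first exact: cube_unit_ge0.
by rewrite lerXn2r ?nnegrE// (le_trans r0).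
Qed.

Context (P : set V -> bool) (D : R) (locP : local_property D P).
Context (m : R) (Pm : max_density P = m%:E) (m0 : 0 < m).
Context (c0 : 0 < @cube_unit R d).

Let m1 : m <= 1.
Proof. by have := max_density_le1 c0 P; rewrite Pm lee_fin. Qed.

(** [ET] pairs a set with the side from which on its centred cubes have density
    within [e] of [m] and the gap [D] around them is negligible. *)
Let good (e : R) (ET : set V * R) : Prop :=
  [/\ lebesgue_measurable ET.1, P ET.1, 0 < ET.2 & forall r, ET.2 <= r ->
    [/\ ((m - e) * vol r)%:E <= lebesgue_Rd (ET.1 `&` cube 0 r),
        (lebesgue_Rd (ET.1 `&` cube 0 r) <= ((m + e) * vol r)%:E) &
        ((vol (r + 2 * D))%:E <= ((1 + e) * vol r)%:E)]%E].

Let good_exists (e : R) : 0 < e -> exists ET, good e ET.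
Proof.
move=> e0; have D0 := local_gap_gt0 locP.
have [E [r1 [mE PE hE]]] := dense_in_large_cubes c0 locP Pm m0 e0.
have [r2 r20 h2] := lebesgue_le_max_density c0 locP Pm m0 e0.
have [|r3 r30 h3] := @expr_shift_le _ d.+1 (2 * D) e _ e0; first lra.
exists (E, Num.max r1 (Num.max r2 r3)); split => //=.
  by rewrite !lt_max r20 orbT.
move=> r; rewrite !ge_max => /and3P[rr1 rr2 rr3]; split; first exact: hE.
  have mEr : lebesgue_measurable (E `&` cube 0 r).
    by apply: lebesgue_measurableI => //; exact: measurable_cube.
  apply: (h2 r _ 0) => //; first by apply: (local_sub locP mE) => // x [].
  by move=> y i [_ /(_ i)/ltW].
by rewrite lee_fin /cube_vol mulrCA ler_pM2l// h3.
Qed.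

(** Sets of densities increasing to [m] are used in successive shells, separated
    by gaps of width [D]. The radii grow so fast that at every scale only two
    consecutive shells matter: the inner ones have negligible volume. *)
Lemma attaining_centred_cubes : exists A,
  [/\ lebesgue_measurable A, P A & forall e, 0 < e -> exists r0, forall r, r0 <= r ->
    (((m - e) * vol r)%:E <= lebesgue_Rd (A `&` cube 0 r))%E].
Proof.
have D0 := local_gap_gt0 locP.
pose eps (k : nat) : R := k.+1%:R^-1.
have eps0 k : 0 < eps k by rewrite invr_gt0.
have eps1 k : eps k <= 1 by rewrite invf_le1// ler1n.
have epsS k : eps k.+1 <= eps k by rewrite lef_pV2 ?posrE// ler_nat.
have [F goodF] : {F : nat -> set V * R & forall k, good (eps k) (F k)}.
  apply: (@choice _ _ (fun k => good (eps k))) => k; exact: good_exists.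
have mF k : lebesgue_measurable (F k).1 by case: (goodF k).
have PF k : P (F k).1 by case: (goodF k).
have T0 k : 0 < (F k).2 by case: (goodF k).
have hF k := let: And4 _ _ _ h := goodF k in h.
(* The summand [F j.+1].2 puts the radius beyond the threshold of the next set;
   the factor [j.+2] makes the cube removed from a shell negligible in it. *)
pose fix rad k := if k is j.+1 then (F j.+1).2 + j.+2%:R * (rad j + 2 * D)
  else (F 0%N).2.
have radT k : 0 < (F k).2 <= rad k.
  rewrite T0/=; elim: k => [|k IH] //=; rewrite lerDl mulr_ge0//.
  have := T0 k; lra.
have rad0 k : 0 < rad k by have /andP[] := radT k; exact: lt_le_trans.
have radS k : k.+2%:R * (rad k + 2 * D) <= rad k.+1 by rewrite /= lerDr ltW.
have radS' k : rad k + 2 * D <= rad k.+1.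
  apply: le_trans (radS k); rewrite ler_peMl ?ler1n//; have := rad0 k; lra.
have radle j k : (j <= k)%N -> rad j <= rad k.
  move=> jk; rewrite -(subnK jk); elim: (k - j)%N => [|n IH] //.
  by apply: (le_trans IH); rewrite addSn; have := radS' (n + j)%N; lra.
have rad_ge k : k%:R * (2 * D) <= rad k.
  elim: k => [|k IH]; first by rewrite mul0r ltW.
  by apply: le_trans (radS' k); rewrite -natr1 mulrDl mul1r lerD2r.
pose S k := ((F k).1 `&` cube 0 (rad k.+1)) `\` cube 0 (rad k + 2 * D).
have mFc k r : lebesgue_measurable ((F k).1 `&` cube 0 r).
  by apply: lebesgue_measurableI => //; exact: measurable_cube.
have mS k : lebesgue_measurable (S k).
  by apply: lebesgue_measurableD; [exact: mFc|exact: measurable_cube].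
have farlt j k : (j < k)%N -> far_apart D (S j) (S k).
  move=> jk x y [Sx _] Sy.
  apply: (@far_apart_shells D (rad j.+1) (rad k + 2 * D) _ _ _ x y Sx Sy).
  by rewrite lerD2r; exact: radle.
have far j k : j != k -> far_apart D (S j) (S k).
  by rewrite neq_ltn => /orP[/farlt//|/farlt/far_apart_sym].
exists (\bigcup_k S k); split.
- exact: lebesgue_measurable_bigcup.
- apply: (local_bigcup locP) => // k; apply: (local_sub locP (mF k)) => //.
  by move=> x [[]].
move=> e e0.
have [j0 hj0] : exists j0, forall j, (j0 <= j)%N -> 6 * eps j <= e.
  exists (Num.truncn (6 / e)) => j jj; rewrite /eps ler_pdivrMr// mulrC -ler_pdivrMr//.
  by apply: le_trans (ltW (truncnS_gt _)) _; rewrite ler_nat ltnS.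
exists (rad j0.+1) => r rr.
have [j jj0 /andP[rj jr]] : exists2 j, (j0 <= j)%N & rad j.+1 <= r < rad j.+2.
  have ex : exists n, r < rad n.
    exists (Num.truncn (r / (2 * D))).+1; apply: lt_le_trans (rad_ge _).
    by rewrite -ltr_pdivrMr ?truncnS_gt//; lra.
  case: (ex_minnP ex) => n rn nmin.
  have jn : (j0.+1 < n)%N.
    rewrite ltnNge; apply/negP => /radle nj; lra.
  case: n jn rn nmin => [|[|j]]// jn rn nmin.
  exists j => //; rewrite rn andbT leNgt; apply/negP => /nmin; by rewrite ltnn.
have rgt0 : 0 < r by apply: lt_le_trans rj.
have fj : (((m - eps j) * vol (rad j.+1) - vol (rad j + 2 * D))%:E <= lebesgue_Rd (S j))%E.
  have [h _ _] := hF j (rad j.+1) (le_trans (andP (radT j)).2 (radle _ _ (leqnSn j))).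
  apply: lebesgue_setD_ge => //; first exact: measurable_cube.
  rewrite -(lebesgue_cube 0); last by have := rad0 j; lra.
  by apply: lebesgue_Rd_le => x [].
have radj1 : (F j.+1).2 <= rad j.+1 by have /andP[] := radT j.+1.
pose B := ((F j.+1).1 `&` cube 0 r) `\` cube 0 (rad j.+1 + 2 * D).
have [_ _ hvol] := hF j.+1 _ radj1.
have fj1 : (((m - eps j.+1) * vol r - (m + eps j.+1) * vol (rad j.+1 + 2 * D))%:E
    <= lebesgue_Rd B)%E.
  have [h _ _] := hF j.+1 r (le_trans radj1 rj).
  apply: lebesgue_setD_ge => //; first exact: measurable_cube.
  have [|_ h' _] := hF j.+1 (rad j.+1 + 2 * D); first lra.
  by apply: le_trans h'; apply: lebesgue_Rd_le => x [[]].
(* At scale [r] only the last complete shell and the current, possibly truncated,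
   one are kept. *)
have SB : S j `|` B `<=` (\bigcup_k S k) `&` cube 0 r.
  move=> x [Sx|[[Fx xr] xB]].
    split; first by exists j.
    by apply: (le_cube rj); case: Sx => -[].
  split => //; exists j.+1 => //; split => //; split => //.
  by apply: (le_cube (ltW jr)).
apply: le_trans (lebesgue_Rd_le SB).
rewrite lebesgue_setU_disj//; last first.
- apply: (far_apart_disj D0); move=> x y Sx [[Fy yr] yB].
  apply: (farlt j j.+1) => //; split => //; split => //.
  by apply: (le_cube (ltW jr)).
- apply: lebesgue_measurableD; [exact: mFc|exact: measurable_cube].
apply: le_trans (leeD fj fj1); rewrite -EFinD lee_fin.
move: hvol; rewrite lee_fin => hvol.
have small : vol (rad j + 2 * D) <= eps j.+1 * vol (rad j.+1).
  rewrite [leRHS]mulrC /eps ler_pdivlMr//.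
  have q0 : 0 <= rad j + 2 * D by have := rad0 j; lra.
  apply: (@le_trans _ _ (vol (j.+2%:R * (rad j + 2 * D)))); last first.
    by apply: le_cube_vol => //; rewrite mulr_ge0.
  rewrite /cube_vol exprMn mulrCA mulrC; apply: ler_wpM2r.
    by rewrite mulr_ge0 ?cube_unit_ge0 ?exprn_ge0.
  by rewrite exprS ler_peMr// exprn_ege1// ler1n.
have w0 := ltW (cube_vol_gt0 c0 (rad0 j.+1)).
have wv := le_cube_vol (ltW (rad0 j.+1)) rj.
have e6 := hj0 _ jj0; have a0 := eps0 j.+1; have ab := epsS j; have b1 := eps1 j.
move: e6 a0 ab b1 small hvol w0 wv.
move: (eps j) (eps j.+1) (vol (rad j + _)) (vol (rad j.+1)) (vol (rad j.+1 + _)) (vol r).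
move=> b a s w w' v e6 a0 ab b1 small hvol w0 wv.
have h1 : (m + a) * w' <= (m + 3 * a) * w.
  apply: (@le_trans _ _ ((m + a) * ((1 + a) * w))).
  by apply: ler_wpM2l; [apply: addr_ge0; exact: ltW|exact: hvol].
  by rewrite mulrA; apply: ler_wpM2r => //; have := m1; nra.
have h2 : (b + 4 * a) * w <= (b + 4 * a) * v by apply: ler_wpM2l => //; lra.
have h3 : (b + 5 * a) * v <= e * v by apply: ler_wpM2r; lra.
by nra.
Qed.

End gluing.

(** * Exhausting an open set by the cells of a grid *)

Section grid.
Context {R : realType} {d : nat}.
Notation V := 'rV[R]_d.+1.
Notation vol := (@cube_vol R d).
Context (L : R) (L0 : 0 < L).
Implicit Types (A : set V) (x y : V).

Definition side (N : nat) : R := 2 * L / N%:R.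

(** Half-open cells of equal side tile the half-open cube of centre 0 and side
    [2 * L] exactly, so that volumes add up without boundary terms. *)
Definition cell N (z : {ffun 'I_d.+1 -> 'I_N}) : set V :=
  halfopen_cube (\row_i (side N * (z i)%:R - L)) (side N).

Lemma cellE N (z : {ffun 'I_d.+1 -> 'I_N}) x : cell z x <->
  forall i, side N * (z i)%:R < x 0 i + L <= side N * (z i).+1%:R.
Proof.
split=> h i; have := h i; rewrite !mxE -natr1 mulrDr mulr1 => /andP[? ?];
  by apply/andP; split; lra.
Qed.

Lemma side_gt0 N : (0 < N)%N -> 0 < side N.
Proof. by move=> N0; rewrite divr_gt0 ?mulr_gt0// ltr0n. Qed.

Lemma sideM N : (0 < N)%N -> side N * N%:R = 2 * L.
Proof. by move=> N0; rewrite divfK// pnatr_eq0 -lt0n. Qed.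

Lemma trivIset_cell N : (0 < N)%N -> trivIset setT (@cell N).
Proof.
move=> N0 z z' _ _ [x [/cellE xz /cellE xz']]; have s0 := side_gt0 N0.
apply/ffunP => i; apply/val_inj/eqP => /=.
have /andP[a b] := xz i; have /andP[a' b'] := xz' i.
have := lt_le_trans a b'; have := lt_le_trans a' b.
by rewrite !ltr_pM2l// !ltr_nat !ltnS eqn_leq => -> ->.
Qed.

Lemma cell_cover N x : (0 < N)%N -> (forall i, - L < x 0 i <= L) ->
  exists z : {ffun 'I_d.+1 -> 'I_N}, cell z x.
Proof.
move=> N0 xL; have s0 := side_gt0 N0; have sN := sideM N0.
have h i : exists k : 'I_N, side N * k%:R < x 0 i + L <= side N * k.+1%:R.
  have /andP[x1 x2] := xL i.
  have ex : exists k : nat, x 0 i + L <= side N * k.+1%:R.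
    by exists N.-1; rewrite prednK// sN; lra.
  case: (ex_minnP ex) => k xk kmin.
  have kN : (k < N)%N.
    by rewrite -(prednK N0) ltnS; apply: kmin; rewrite prednK// sN; lra.
  exists (Ordinal kN); rewrite xk andbT /=.
  case: k xk kmin kN => [|k] xk kmin kN; first by rewrite mulr0; lra.
  by rewrite ltNge; apply/negP => /kmin; rewrite ltnn.
exists [ffun i => projT1 (cid (h i))]; apply/cellE => i.
by rewrite ffunE; case: cid.
Qed.

(** Halving the side of the grid subdivides its cells; this is what makes the
    dyadic inner approximations of a set increase. *)
Lemma cell_refine N (z : {ffun 'I_d.+1 -> 'I_N})
    (z' : {ffun 'I_d.+1 -> 'I_(2 * N)}) x :
  (0 < N)%N -> cell z x -> cell z' x -> cell z' `<=` cell z.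
Proof.
move=> N0 /cellE xz /cellE xz' y /cellE yz'; apply/cellE => i.
have N20 : (0 < 2 * N)%N by rewrite muln_gt0.
have s0 := side_gt0 N20.
have sE : side N = side (2 * N) * 2.
  by rewrite /side natrM invfM; field; rewrite pnatr_eq0 -lt0n.
have /andP[a b] := xz i; have /andP[a' b'] := xz' i; have /andP[a'' b''] := yz' i.
rewrite !sE in a b *.
move: (side (2 * N)) s0 {sE} a b a' b' a'' b'' => h s0 a b a' b' a'' b''.
rewrite -!mulrA -!natrM in a b *.
have := lt_le_trans a b'; have := lt_le_trans a' b.
rewrite !ltr_pM2l// !ltr_nat !ltnS => u v; apply/andP; split.
  by apply: le_lt_trans a''; rewrite ler_pM2l// ler_nat.
by apply: (le_trans b''); rewrite ler_pM2l// ler_nat.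
Qed.

Lemma measurable_cell N (z : {ffun 'I_d.+1 -> 'I_N}) : lebesgue_measurable (cell z).
Proof. exact: measurable_box. Qed.

Lemma lebesgue_cell N (z : {ffun 'I_d.+1 -> 'I_N}) : (0 < N)%N ->
  lebesgue_Rd (cell z) = (vol (side N))%:E.
Proof. by move=> N0; rewrite lebesgue_halfopen_cube// side_gt0. Qed.

Lemma cell_near N (z : {ffun 'I_d.+1 -> 'I_N}) x y :
  cell z x -> cell z y -> forall i, `|x 0 i - y 0 i| < side N.
Proof.
move=> /cellE xz /cellE yz i; have := xz i; have := yz i.
by rewrite -natr1 mulrDr mulr1 ltr_norml => /andP[? ?] /andP[? ?]; apply/andP; split; lra.
Qed.

Definition inner_cells (Omega : set V) N : pred {ffun 'I_d.+1 -> 'I_N} :=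
  fun z => `[< cell z `<=` Omega >].

Definition inner_union Omega N : set V :=
  \bigcup_(z in [set` inner_cells Omega (N := N)]) cell z.

Lemma measurable_inner_union Omega N : lebesgue_measurable (inner_union Omega N).
Proof.
apply: (@fin_bigcup_measurable _ (caratheodory_type (@lebesgue_Rd R d.+1))) => // z _.
exact: measurable_cell.
Qed.

Lemma inner_union_sub Omega N : inner_union Omega N `<=` Omega.
Proof. by move=> x [z /asboolP]; apply. Qed.

Section open_set.
Context (Omega : set V) (oOmega : open Omega)
  (OmegaL : forall x i, Omega x -> - L < x 0 i <= L).

Lemma inner_union_nondecreasing :
  nondecreasing_seq (fun j => inner_union Omega (2 ^ j)).
Proof.
apply/nondecreasing_seqP => j; apply/subsetPset => x [z /asboolP zO zx].
have N0 : (0 < 2 ^ j)%N by rewrite expn_gt0.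
have N1 : (0 < 2 ^ j.+1)%N by rewrite expn_gt0.
have [z' z'x] := cell_cover N1 (fun i => OmegaL i (zO _ zx)).
exists z' => //; apply/asboolP; apply: subset_trans zO.
move: z' z'x; rewrite expnS => z' z'x; exact: cell_refine zx z'x.
Qed.

Lemma bigcup_inner_union : \bigcup_j inner_union Omega (2 ^ j) = Omega.
Proof.
apply/seteqP; split => [x [j _]|x Ox]; first exact: inner_union_sub.
have /nbhs_ballP[e /= e0 eO] : nbhs x Omega by exact: open_nbhs_nbhs.
exists (Num.truncn (2 * L / e)).+1 => //.
set N := (2 ^ _)%N; have N0 : (0 < N)%N by rewrite expn_gt0.
have se : side N < e.
  rewrite ltr_pdivrMr ?ltr0n// [ltRHS]mulrC -ltr_pdivrMr//.
  apply: lt_le_trans (truncnS_gt _) _; rewrite ler_nat; exact/ltnW/ltn_expl.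
have [z zx] := cell_cover N0 (fun i => OmegaL i Ox).
exists z => //; apply/asboolP => y zy; apply: eO; split => // i j; rewrite !ord1.
by rewrite /ball /=; apply: lt_trans se; exact: cell_near zx zy _.
Qed.

Lemma measurable_open : lebesgue_measurable Omega.
Proof.
rewrite -bigcup_inner_union.
by apply: lebesgue_measurable_bigcup => j; exact: measurable_inner_union.
Qed.

Lemma lebesgue_inner_union N : (0 < N)%N ->
  lebesgue_Rd (inner_union Omega N) =
  (#|inner_cells Omega (N := N)|%:R * vol (side N))%:E.
Proof.
move=> N0; rewrite lebesgue_bigcup_fin; first last.
- by apply: sub_trivIset (trivIset_cell N0).
- by move=> z _; exact: measurable_cell.
rewrite (eq_bigr (fun=> (vol (side N))%:E)) => [|z _]; last exact: lebesgue_cell.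
by rewrite sumEFin sumr_const mulr_natl.
Qed.

Lemma lebesgue_bounded_fin : lebesgue_Rd Omega \is a fin_num.
Proof.
rewrite ge0_fin_numE ?lebesgue_Rd_ge0//.
apply: (@le_lt_trans _ _ (lebesgue_Rd (halfopen_cube (const_mx (- L) : V) (2 * L)))).
  apply: lebesgue_Rd_le => x Ox i; have /andP[? ?] := OmegaL i Ox; rewrite !mxE.
  by apply/andP; split; lra.
by rewrite lebesgue_halfopen_cube ?ltey// mulr_gt0.
Qed.

(** An open set is exhausted by the dyadic cells that it contains. *)
Lemma inner_cells_approx e : 0 < e -> exists N, (0 < N)%N /\
  fine (lebesgue_Rd Omega) - e <=
    #|inner_cells Omega (N := N)|%:R * vol (side N) <= fine (lebesgue_Rd Omega).
Proof.
move=> e0.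
have cvg : (lebesgue_Rd (inner_union Omega (2 ^ j))) @[j --> \oo] --> lebesgue_Rd Omega.
  rewrite -[in X in _ --> X]bigcup_inner_union.
  apply: (@nondecreasing_cvg_mu _ _ _ (lebesgue R d)).
  - by move=> j; exact: measurable_inner_union.
  - rewrite bigcup_inner_union; exact: measurable_open.
  - exact: inner_union_nondecreasing.
have := lebesgue_bounded_fin; move: cvg.
have le j : (lebesgue_Rd (inner_union Omega (2 ^ j)) <= lebesgue_Rd Omega)%E.
  by apply: lebesgue_Rd_le; exact: inner_union_sub.
move: le; case: (lebesgue_Rd Omega) => [v| |] //= le /fine_cvgP[_ cvg] _.
have /cvgrPdist_le/(_ _ e0) [j _ /(_ j (leqnn j)) /=] := cvg.
have N0 : (0 < 2 ^ j)%N by rewrite expn_gt0.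
have := le j; rewrite lebesgue_inner_union// lee_fin /= => le1.
rewrite ger0_norm ?subr_ge0// => h; exists (2 ^ j)%N; split => //.
by apply/andP; split => //; lra.
Qed.

Lemma lebesgue_open_gt0 : 0 < @cube_unit R d -> Omega !=set0 ->
  0 < fine (lebesgue_Rd Omega).
Proof.
move=> c0 [x Ox]; move: (Ox); rewrite -{1}bigcup_inner_union => -[j _ [z /asboolP zO zx]].
have N0 : (0 < 2 ^ j)%N by rewrite expn_gt0.
have : (lebesgue_Rd (cell z) <= lebesgue_Rd Omega)%E by exact: lebesgue_Rd_le.
rewrite lebesgue_cell// -(fineK lebesgue_bounded_fin) lee_fin; apply: lt_le_trans.
by apply: cube_vol_gt0 => //; exact: side_gt0.
Qed.

End open_set.
End grid.

(** * Dilates of an open set *)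

Section dilations.
Context {R : realType} {d : nat}.
Notation V := 'rV[R]_d.+1.
Notation vol := (@cube_vol R d).
Implicit Types (A Omega : set V) (e t : R).

Lemma cube_volM t s : vol (t * s) = t ^+ d.+1 * vol s.
Proof. by rewrite /cube_vol exprMn mulrCA. Qed.

Lemma measurable_dilate t A : 0 < t ->
  lebesgue_measurable A -> lebesgue_measurable (dilate t A).
Proof. by rewrite dilate_affine; exact: measurable_affine. Qed.

Lemma lebesgue_dilate t A (v : R) : 0 < t -> lebesgue_Rd A = v%:E ->
  lebesgue_Rd (dilate t A) = (t ^+ d.+1 * v)%:E.
Proof. by move=> t0 Av; rewrite dilate_affine lebesgue_affine// Av EFinM. Qed.

Lemma dilate_disj t A B : 0 < t -> A `&` B = set0 -> dilate t A `&` dilate t B = set0.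
Proof.
move=> t0 AB; apply/seteqP; split => // _ [[a Aa <-] [b Bb ba]].
have : (A `&` B) a by split => //; rewrite -(scalerI (lt0r_neq0 t0) ba).
by rewrite AB.
Qed.

Context (L : R) (L0 : 0 < L).

Lemma lebesgue_cells_le N (Q : pred {ffun 'I_d.+1 -> 'I_N}) A t (b : R) :
  (0 < N)%N -> 0 < t -> lebesgue_measurable A ->
  (forall z : {ffun 'I_d.+1 -> 'I_N},
    (lebesgue_Rd (A `&` dilate t (cell L z)) <= b%:E)%E) ->
  (lebesgue_Rd (\bigcup_(z in [set` Q]) (A `&` dilate t (cell L z)))
     <= (#|Q|%:R * b)%:E)%E.
Proof.
move=> N0 t0 mA Ab; rewrite lebesgue_bigcup_fin; first last.
- apply: (@sub_trivIset _ _ _ setT) => //; apply/trivIsetP => z z' _ _ zz'.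
  rewrite setIACA setIid (dilate_disj t0) ?setI0//.
  by move/trivIsetP : (trivIset_cell (d := d) L0 N0); apply.
- move=> z _; apply: lebesgue_measurableI => //; apply: measurable_dilate => //.
  exact: measurable_cell.
apply: (@le_trans _ _ (\sum_(z | Q z) b%:E)%E); first exact: lee_sum.
by rewrite sumEFin sumr_const mulr_natl.
Qed.

Context (P : set V -> bool) (D : R) (locP : local_property D P).
Context (m : R) (Pm : max_density P = m%:E) (m0 : 0 < m).
Context (c0 : 0 < @cube_unit R d).
Context (A : set V) (mA : lebesgue_measurable A) (PA : P A).

Let m1 : m <= 1.
Proof. by have := max_density_le1 c0 P; rewrite Pm lee_fin. Qed.

(** The dilates of a cell are cubes, large when [t] is, so that the general upper
    bound applies to them. *)
Lemma lebesgue_dilate_cell_le N e : (0 < N)%N -> 0 < e -> exists t0, forall t,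
  t0 <= t -> forall z : {ffun 'I_d.+1 -> 'I_N},
  (lebesgue_Rd (A `&` dilate t (cell L z))
     <= ((m + e) * (t ^+ d.+1 * vol (side L N)))%:E)%E.
Proof.
move=> N0 e0; have [s0 s00 hs] := lebesgue_le_max_density c0 locP Pm m0 e0.
have h0 := side_gt0 L0 N0.
exists (s0 / side L N) => t; rewrite ler_pdivrMr// => ts z.
have t0 : 0 < t by have := lt_le_trans s00 ts; rewrite pmulr_lgt0.
rewrite -cube_volM.
pose x : V := t *: (\row_i (side L N * (z i)%:R - L) + const_mx (side L N / 2)).
have mAz : lebesgue_measurable (A `&` dilate t (cell L z)).
  by apply: lebesgue_measurableI => //; apply: measurable_dilate => //; exact: measurable_cell.
apply: (hs _ _ x) => //; first by apply: (local_sub locP mA) => // y [].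
move=> _ i [_ [y yz <-]]; have := yz i; rewrite !mxE => /andP[y1 y2].
rewrite -mulrBr normrM gtr0_norm// -mulrA ler_pM2l// ler_norml.
by apply/andP; split; lra.
Qed.

(** Cells inside [Omega] carry at most their share of [A], which bounds the
    density from above; so do the cells not inside [Omega], and what they leave
    of the mass of [A] in a large cube bounds the density from below. *)
Lemma density_dilate_cvg Omega :
  (forall e, 0 < e -> exists r0, forall r, r0 <= r ->
    (((m - e) * vol r)%:E <= lebesgue_Rd (A `&` cube 0 r))%E) ->
  open Omega -> Omega !=set0 -> (forall x i, Omega x -> - L < x 0 i <= L) ->
  density (dilate t Omega) A @[t --> +oo] --> m%:E.
Proof.
move=> hA oO O0 OL; have v0 := lebesgue_open_gt0 L0 oO OL c0 O0.
have mO := measurable_open L0 oO OL.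
have Ofin := fineK (lebesgue_bounded_fin L0 OL).
set v := fine (lebesgue_Rd Omega) in v0 Ofin.
have W0 : 0 < vol (2 * L) by apply: cube_vol_gt0 => //; rewrite mulr_gt0.
set W := vol (2 * L) in W0.
suff main e : 0 < e -> exists t0, forall t, t0 <= t ->
    0 < t /\ (((m - e) * (t ^+ d.+1 * v))%:E <= lebesgue_Rd (A `&` dilate t Omega)
      <= ((m + e) * (t ^+ d.+1 * v))%:E)%E.
  have near_fin e : 0 < e -> \forall t \near +oo, exists2 u,
      density (dilate t Omega) A = u%:E & m - e <= u <= m + e.
    move=> e0; have [t0 ht] := main e e0.
    exists t0; split; first exact: num_real.
    move=> t /ltW/ht[tgt0 /andP[l u]].
    have tv0 : 0 < t ^+ d.+1 * v by rewrite mulr_gt0// exprn_gt0.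
    rewrite (densityE _ (lebesgue_dilate tgt0 (esym Ofin)))//.
    move: l u; case: (lebesgue_Rd _) => [a| |]; rewrite ?leNye_eq//.
    rewrite !lee_fin => l u; exists (a / (t ^+ d.+1 * v)) => //.
    by rewrite ler_pdivlMr// ler_pdivrMr// l.
  apply/fine_cvgP; split.
    by near=> t; have [u -> _] : exists2 u, density (dilate t Omega) A = u%:E &
      m - 1 <= u <= m + 1 by near: t; exact: near_fin.
  apply/cvgrPdist_le => e e0; near=> t.
  have [u fu /andP[? ?]] : exists2 u, density (dilate t Omega) A = u%:E &
      m - e <= u <= m + e by near: t; exact: near_fin.
  by rewrite /= fu /= ler_norml; apply/andP; split; lra.
(* Chosen so that the errors of both bounds, at most [e1 * (v + 1)] and
   [e1 * (1 + 2 * W)] by [m <= 1], stay below [e * v]. *)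
move=> e0; pose e1 := e * v / (v + 2 + 2 * W).
have den0 : 0 < v + 2 + 2 * W by lra.
have e10 : 0 < e1 by rewrite divr_gt0// mulr_gt0.
have e1E : e1 * (v + 2 + 2 * W) = e * v by rewrite divfK// gt_eqF.
clearbody e1.
have [N [N0 /andP[uv1 uv2]]] := inner_cells_approx L0 oO OL e10.
rewrite -/v in uv1 uv2.
have [tc hc] := lebesgue_dilate_cell_le N0 e10.
have [tr hr] := hA e1 e10.
set G := inner_cells L Omega (N := N) in uv1 uv2.
set w := vol (side L N) in uv1 uv2 hc.
have w0 : 0 < w by apply: cube_vol_gt0 => //; exact: side_gt0.
exists (Num.max 1 (Num.max tc (tr / (2 * L)))) => t; rewrite !ge_max => /and3P[t1 tct trt].
have t0 : 0 < t by lra.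
split => //; set k := t ^+ d.+1 in hc *; have k0 : 0 < k by exact: exprn_gt0.
have part Q := @lebesgue_cells_le N Q A t _ N0 t0 mA (hc t tct).
have U_E := lebesgue_inner_union L0 Omega N0; rewrite -/G -/w in U_E.
have mU := @measurable_inner_union R d L Omega N.
have mAt z : lebesgue_measurable (A `&` dilate t (cell L (z : {ffun 'I_d.+1 -> 'I_N}))).
  by apply: lebesgue_measurableI => //; apply: measurable_dilate => //; exact: measurable_cell.
have mAQ (Q : pred {ffun 'I_d.+1 -> 'I_N}) : lebesgue_measurable
    (\bigcup_(z in [set` Q]) (A `&` dilate t (cell L z))).
  by apply: (@fin_bigcup_measurable _ (caratheodory_type (@lebesgue_Rd R d.+1)))
    => // z _; exact: mAt.
have mAO : lebesgue_measurable (A `&` dilate t Omega).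
  by apply: lebesgue_measurableI => //; exact: measurable_dilate.
have subadd (B C : set V) : lebesgue_measurable B -> lebesgue_measurable C ->
  (lebesgue_Rd (B `|` C) <= lebesgue_Rd B + lebesgue_Rd C)%E :=
  @measureU2 _ _ _ (lebesgue R d) B C.
apply/andP; split.
- have sub : A `&` cube 0 (t * (2 * L)) `<=` (A `&` dilate t Omega) `|`
      (\bigcup_(z in [set` predC G]) (A `&` dilate t (cell L z))).
    move=> y [Ay yt].
    have yL i : - L < (t^-1 *: y) 0 i <= L.
      have := yt i; rewrite !mxE subr0 (_ : t * (2 * L) / 2 = L * t) => [yi|]; last by field.
      have : `|t^-1 * y 0 i| < L.
        by rewrite normrM gtr0_norm ?invr_gt0// mulrC ltr_pdivrMr.
      by rewrite ltr_norml => /andP[-> /ltW].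
    have [z zy] := cell_cover L0 N0 yL.
    have yE : t *: (t^-1 *: y) = y by rewrite scalerA mulfV ?gt_eqF// scale1r.
    have [/asboolP zG|zG] := boolP (G z).
      by left; split => //; exists (t^-1 *: y) => //; exact: zG.
    by right; exists z => //; split => //; exists (t^-1 *: y).
  have trL : tr <= t * (2 * L) by move: trt; rewrite ler_pdivrMr ?mulr_gt0.
  have low := le_trans (hr _ trL)
    (le_trans (lebesgue_Rd_le sub) (subadd _ _ mAO (mAQ _))).
  have {}low := le_trans low (leeD2l _ (part (predC G))).
  have cardE : (#|G|%:R + #|predC G|%:R) * w = W.
    rewrite -natrD cardC card_ffun !card_ord natrX /W -(sideM L N0).
    by rewrite [side L N * _]mulrC cube_volM.
  rewrite -leeBlDr// in low; apply: le_trans low; rewrite -EFinB lee_fin.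
  rewrite cube_volM -/k -/W.
  have nE : #|predC G|%:R * ((m + e1) * (k * w)) = k * ((m + e1) * (W - #|G|%:R * w)).
    by rewrite -cardE; ring.
  have u0 : 0 <= #|G|%:R * w by rewrite mulr_ge0// ltW.
  rewrite nE; move: (#|G|%:R * w) u0 uv1 uv2 => u u0 uv1 uv2.
  have h : (m - e) * v <= (m - e1) * W - (m + e1) * (W - u).
    have h1 : m * (v - e1) <= m * u by apply: ler_wpM2l => //; exact: ltW.
    have h2 : m * e1 <= e1 by rewrite ler_piMl// ltW.
    have h3 : 0 <= e1 * (v + 1 + u) by rewrite mulr_ge0//; lra.
    lra.
  have := ler_wpM2l (ltW k0) h; lra.
- have sub : A `&` dilate t Omega `<=`
      (\bigcup_(z in [set` G]) (A `&` dilate t (cell L z))) `|`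
      dilate t (Omega `\` inner_union L Omega N).
    move=> x [Ax [y Oy yx]]; rewrite -yx in Ax *.
    have [Uy|Uy] := pselect (inner_union L Omega N y).
      by left; have [z zG zy] := Uy; exists z => //; split => //; exists y.
    by right; exists y.
  have mOU := lebesgue_measurableD mO mU.
  apply: le_trans (lebesgue_Rd_le sub) _.
  apply: le_trans (subadd _ _ (mAQ _) (measurable_dilate t0 mOU)) _.
  have OU : lebesgue_Rd (Omega `\` inner_union L Omega N) = (v - #|G|%:R * w)%:E.
    have := measureDI (lebesgue R d) mO mU.
    rewrite /= (setIidr (@inner_union_sub _ _ L Omega N)).
    rewrite U_E -Ofin; case: (lebesgue_Rd _) => [a| |] //= [->].
    by rewrite addrK.
  rewrite (lebesgue_dilate t0 OU); apply: le_trans (leeD2r _ (part G)) _.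
  rewrite -EFinD lee_fin -/k.
  have -> : #|G|%:R * ((m + e1) * (k * w)) = k * ((m + e1) * (#|G|%:R * w)) by ring.
  move: (#|G|%:R * w) uv1 uv2 => u uv1 uv2.
  have h : (m + e1) * u + (v - u) <= (m + e) * v.
    have h1 : m * u <= m * v by apply: ler_wpM2l => //; exact: ltW.
    have h2 : e1 * u <= e1 * v by apply: ler_wpM2l => //; exact: ltW.
    have h3 : 0 <= e1 * (1 + 2 * W) by rewrite mulr_ge0//; lra.
    lra.
  have := ler_wpM2l (ltW k0) h; lra.
Unshelve. all: by end_near. Qed.

End dilations.

Theorem corollary13 (R : realType) (d : nat) (hd : (2 <= d)%N)
    (P : set 'rV[R]_d -> bool)
    (P_finite : boundedly_finite P) (P_supersaturable : supersaturable P) :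
  exists A : set 'rV[R]_d,
    [/\ lebesgue_measurable A, P A &
      forall Omega : set 'rV[R]_d,
        Omega !=set0 -> open Omega -> bounded_set Omega ->
        density (dilate t Omega) A @[t --> +oo] --> max_density P].
Proof.
case: d hd P P_finite P_supersaturable => // d _ P P_finite P_sat.
have m_gt0 : (0 < max_density P)%E by have [I /sat_max_density_gt0] := P_sat.
have c0 := cube_unit_gt0 m_gt0.
have [D locP] := local_property_of_supersaturable P_finite P_sat.
have m_le1 := max_density_le1 c0 P.
have /fineK Pm : max_density P \is a fin_num.
  by rewrite ge0_fin_numE ?(ltW m_gt0)// (le_lt_trans m_le1)// ltey.
rewrite -Pm lte_fin in m_gt0.
have [A [mA PA hA]] := attaining_centred_cubes locP (esym Pm) m_gt0 c0.
exists A; split => // Omega O0 oO [M [_ OM]]; rewrite -Pm.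
have [L L0 OL] : exists2 L, 0 < L & forall x i, Omega x -> - L < x 0 i <= L.
  exists (`|M| + 2) => [|x i Ox]; first by rewrite ltr_wpDl.
  have xM : `|x| <= `|M| + 1.
    by apply: OM => //; apply: le_lt_trans (ler_norm M) _; rewrite ltrDl.
  have /le_trans/(_ xM) : `|x 0 i| <= `|x|.
    rewrite -[`|x|]/(mx_norm x) mx_normrE.
    exact: (le_bigmax _ (fun ij => `|x ij.1 ij.2|) (0, i)).
  by rewrite ler_norml => /andP[? ?]; apply/andP; split; lra.
by apply: (density_dilate_cvg L0 locP (esym Pm) m_gt0 c0 mA PA hA).
Qed.
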